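(* Let $V$ be a real separable Banach space with dual $V'$, and let $\mathcal{A}:D(\mathcal{A})\to 2^{V}$ be a densely defined m-accretive operator whose associated semigroup $T_{\mathcal{A}}$ is domain invariant and admits an infinitesimal generator $\mathcal{A}^{\circ}:V\to V$. Let $V^{\ast}\subseteq V'$ separate points, let $x\in\mathcal{M}(\Omega;V)$, $\eta\in\mathcal{M}((0,\infty)\times Z\times\Omega;V)$, and assume that $X_1,X_2:[0,\infty)\times\Omega\to V$ are mild solutions of (ACPRM)$\{x,\eta,V^{\ast}\}$. Then $X_1$ and $X_2$ are indistinguishable.
   Context: **Point processes.** $(\Omega,\mathcal{F},\mathbb{P})$ is a complete probability space and $(Z,\mathcal{Z})$ a measurable space; $\mathfrak{B}(\cdot)$ denotes Borel $\sigma$-algebras. A point function is a map $\theta:D(\theta)\to Z$ with $D(\theta)\subseteq(0,\infty)$ countable; $\pi(Z)$ is the set of all point functions, with the $\sigma$-algebra $\Pi(Z)$ generated by the sets $\{\theta\in\pi(Z):\#\{t\in D(\theta):(t,\theta(t))\in U\}=k\}$, $k\in\mathbb{N}_{0}$, $U\in\mathfrak{B}((0,\infty))\otimes\mathcal{Z}$. A point process is an $\mathcal{F}$-$\Pi(Z)$-measurable map $\Theta:\Omega\to\pi(Z)$; its counting measure is $N_{\Theta}(U,\omega)=\#\{t\in D(\Theta(\omega)):(t,\Theta(\omega)(t))\in U\}$. $\Theta$ is finite if $\mathbb{E}N_{\Theta}((0,t]\times Z)<\infty$ for all $t>0$. A finite point process $\Theta$, with $D(\Theta(\omega))$ infinite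 for a.e. $\omega$, is fixed. Its hitting times are the a.s. unique measurable $\alpha_{m}:\Omega\to(0,\infty)$, $m\in\mathbb{N}$, with, almost surely, $D(\Theta)=\{\alpha_{1},\alpha_{2},\dots\}$ and $0<\alpha_{1}<\alpha_{2}<\cdots$ (then $\alpha_{m}\to\infty$ a.s.); $\alpha_{0}:=0$. Integrals against $N_{\Theta}$ are pathwise (for a.e. $\omega$) Lebesgue integrals w.r.t. $N_{\Theta}(\cdot,\omega)$. **Function spaces.** $\mathcal{M}(\Omega;V)$ is the set of $\mathcal{F}$-$\mathfrak{B}(V)$-measurable maps $\Omega\to V$; $\mathcal{M}((0,\infty)\times Z\times\Omega;V)$ is the set of $\mathfrak{B}((0,\infty))\otimes\mathcal{Z}\otimes\mathcal{F}$-$\mathfrak{B}(V)$-measurable maps. $\langle\cdot,\cdot\rangle_{V}$ is the duality between $V$ and $V'$. $V^{\ast}\subseteq V'$ separates points if $\langle\Phi,v\rangle_{V}=0$ for all $\Phi\in V^{\ast}$ implies $v=0$. $W^{1,1}([a,b];V)$ is the set of $f:[a,b]\to V$ that are absolutely continuous and differentiable a.e. **Operators and semigroups.** A multi-valued operator $\mathcal{A}:V\to 2^{V}$ has $D(\mathcal{A})=\{v:\mathcal{A}v\ne\emptyset\}$ and is identified with its graph $\{(v,\hat v):\hat v\in\mathcal{A}v\}$. It is accretive if $\|v_1-v_2\|_V\le\|v_1-v_2+\alpha(\hat v_1-\hat v_2)\|_V$ for all $\alpha>0$, $(v_i,\hat v_i)\in\mathcal{A}$; m-accretive if moreover $R(\mathrm{Id}+\alpha\mathcal{A})=V$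 for all $\alpha>0$; densely defined if $\overline{D(\mathcal{A})}=V$. For $\mathcal{A}$ m-accretive and densely defined, $T_{\mathcal{A}}(\cdot)v:[0,\infty)\to V$ is the unique mild solution (in the usual sense of nonlinear semigroup theory, i.e. limit of implicit Euler schemes; equivalently $T_{\mathcal{A}}(t)v=\lim_{n}(\mathrm{Id}+\frac{t}{n}\mathcal{A})^{-n}v$) of $0\in u'(t)+\mathcal{A}u(t)$, $u(0)=v$; $(T_{\mathcal{A}}(t))_{t\ge0}$ is the semigroup associated to $\mathcal{A}$. $T_{\mathcal{A}}$ is domain invariant if $T_{\mathcal{A}}(t)v\in D(\mathcal{A})$ for all $t>0$, $v\in V$. $T_{\mathcal{A}}$ admits the infinitesimal generator $\mathcal{A}^{\circ}:V\to V$ if $-\lim_{h\searrow0}\frac{T_{\mathcal{A}}(h)v-v}{h}=\mathcal{A}^{\circ}v\in\mathcal{A}v$ for all $v\in D(\mathcal{A})$, and $\mathcal{A}^{\circ}v=0$ for $v\notin D(\mathcal{A})$. **Solutions.** (ACPRM) is the formal inclusion $\eta(t,z)N_{\Theta}(dt\otimes z)\in dX(t)+\mathcal{A}X(t)dt$. A $\mathfrak{B}([0,\infty))\otimes\mathcal{F}$-$\mathfrak{B}(V)$-measurable process $X:[0,\infty)\times\Omega\to V$ is a strong solution of (ACPRM)$\{x,\eta,V^{\ast}\}$ if for $\mathbb{P}$-a.e. $\omega$: (i) $X(0,\omega)=x(\omega)$; (ii) $t\mapsto X(t,\omega)$ is càdlàg; (iii) $X(t,\omega)\in D(\mathcal{A})$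 for all $t\in(0,\infty)\setminus\{\alpha_m(\omega):m\in\mathbb{N}\}$; (iv) for all $m\in\mathbb{N}_0$ and $[a,b]\subseteq(\alpha_m(\omega),\alpha_{m+1}(\omega))$, $X(\cdot,\omega)|_{[a,b]}\in W^{1,1}([a,b];V)$; (v) $\langle\Psi,\mathcal{A}^{\circ}X(\cdot,\omega)\rangle_V\in L^1(0,t)$ for all $t>0$, $\Psi\in V^{\ast}$; (vi) $\langle\Psi,X(t,\omega)-x(\omega)\rangle_V+\int_0^t\langle\Psi,\mathcal{A}^{\circ}X(\tau,\omega)\rangle_Vd\tau=\int_{(0,t]\times Z}\langle\Psi,\eta(\tau,z,\omega)\rangle_VN_{\Theta}(d\tau\otimes z,\omega)$ for all $t>0$, $\Psi\in V^{\ast}$. A $\mathfrak{B}([0,\infty))\otimes\mathcal{F}$-$\mathfrak{B}(V)$-measurable process $Y$ is a mild solution of (ACPRM)$\{x,\eta,V^{\ast}\}$ if it satisfies (i)-(iv) a.s. and there are $x_m\in\mathcal{M}(\Omega;V)$, $\eta_m\in\mathcal{M}((0,\infty)\times Z\times\Omega;V)$ and strong solutions $X_m$ of (ACPRM)$\{x_m,\eta_m,V^{\ast}\}$ ($m\in\mathbb{N}$) such that almost surely, for all $t>0$, $\lim_m\sup_{\tau\in[0,t]}\|X_m(\tau)-Y(\tau)\|_V=0$ and $\lim_m\int_{(0,t]\times Z}\|\eta_m(\tau,z)-\eta(\tau,z)\|_VN_{\Theta}(d\tau\otimes z)=0$. Two processes are indistinguishable if almost surely they agree for all $t\ge0$.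 *)

(* Defs.v *)
From HB Require Import structures.
From mathcomp Require Import all_boot all_order all_algebra.
From mathcomp Require Import all_classical all_reals all_analysis.
Set Implicit Arguments.
Unset Strict Implicit.
Unset Printing Implicit Defensive.
Import Order.TTheory GRing.Theory Num.Theory.
Import numFieldNormedType.Exports.
Local Open Scope classical_set_scope.
Local Open Scope ring_scope.

(* A point function theta : D(theta) -> Z is encoded as a map R -> option Z,
   with D(theta) the set of points not sent to None. *)
Record point_function (R : realType) (Z : Type) := PointFunction {
  pf_fun :> R -> option Z ;
  pf_gt0 : forall t, pf_fun t <> None -> 0 < t ;
  pf_countable : countable [set t | pf_fun t <> None] }.

Definition pf_dom (R : realType) (Z : Type) (theta : point_function R Z) :
  set R := [set t | theta t <> None].

Definition pf_points (R : realType) (Z : Type) (theta : point_function R Z)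
  (U : set (R * Z)) : set R := [set t | exists2 z, theta t = Some z & U (t, z)].

Section point_function_instances.
Context (R : realType) (Z : Type).

Fact pf_empty_gt0 (t : R) : (None : option Z) <> None -> 0 < t.
Proof. by []. Qed.

Fact pf_empty_countable :
  countable [set t : R | (None : option Z) <> None].
Proof.
have -> : [set t : R | (None : option Z) <> None] = set0.
  by apply/seteqP; split=> t //= /(_ erefl).
exact: countable0.
Qed.

Definition pf_empty : point_function R Z :=
  PointFunction pf_empty_gt0 pf_empty_countable.

HB.instance Definition _ := gen_eqMixin (point_function R Z).
HB.instance Definition _ := gen_choiceMixin (point_function R Z).
HB.instance Definition _ := isPointed.Build (point_function R Z) pf_empty.

End point_function_instances.

(* The trace of B(R) (x) Z on the measurable set (0, oo) x Z is
   B((0, oo)) (x) Z. *)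
Definition pf_generators (R : realType) dZ (Z : measurableType dZ) :
    set (set (point_function R Z)) :=
  [set E | exists U : set (measurableTypeR R * Z), exists k : nat,
    [/\ measurable U, U `<=` `]0, +oo[ `*` setT &
        E = [set theta | (pf_points theta U #= `I_k)%card]]].

Definition point_process (R : realType) dO (Omega : measurableType dO)
    dZ (Z : measurableType dZ) (Theta : Omega -> point_function R Z) :=
  measurable_fun setT
    (Theta : Omega -> g_sigma_algebraType (@pf_generators R dZ Z)).

Section counting_measure_of_point_function.
Context (R : realType) dZ (Z : measurableType dZ).
Variable theta : point_function R Z.
Local Open Scope ereal_scope.

Definition pf_counting (U : set (measurableTypeR R * Z)) : \bar R :=
  counting (pf_points theta U).

Let pf_counting0 : pf_counting set0 = 0.
Proof.
rewrite /pf_counting (_ : pf_points theta set0 = set0); last first.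
  by apply/seteqP; split=> t // -[].
by rewrite /counting asboolT// fset_set0.
Qed.

Let pf_counting_ge0 U : 0 <= pf_counting U.
Proof.
by rewrite /pf_counting /counting; case: ifPn; rewrite ?lee_fin// lee_pinfty.
Qed.

Let pf_counting_sigma_additive : semi_sigma_additive pf_counting.
Proof.
move=> F mF tF mUF; rewrite /pf_counting.
have -> : pf_points theta (\bigcup_n F n) = \bigcup_n pf_points theta (F n).
  apply/seteqP; split=> t.
    by move=> [z tz [n _ Fn]]; exists n => //; exists z.
  by move=> [n _ [z tz Fn]]; exists z => //; exists n.
pose G (n : nat) : set (g_sigma_algebraType [set: set R]) :=
  pf_points theta (F n).
have mG A : measurable (A : set (g_sigma_algebraType [set: set R])).
  exact: sub_sigma_algebra.
apply: (@measure_semi_sigma_additive _ _ _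
  (counting : {measure set (g_sigma_algebraType [set: set R]) -> \bar R}) G).
- by move=> n; exact: mG.
- apply/trivIsetP => i j _ _ ij; apply/seteqP; split=> // t.
  move=> [[z tz Fi] [z' tz' Fj]].
  move: tF => /trivIsetP/(_ i j Logic.I Logic.I ij) /seteqP[+ _].
  apply; split; first exact: Fi.
  by move: tz'; rewrite tz => -[->].
- exact: mG.
Qed.

HB.instance Definition _ := isMeasure.Build _ _ _ pf_counting
  pf_counting0 pf_counting_ge0 pf_counting_sigma_additive.

End counting_measure_of_point_function.

Definition finite_point_process (R : realType) dO (Omega : measurableType dO)
    (P : probability Omega R) dZ (Z : measurableType dZ)
    (Theta : Omega -> point_function R Z) :=
  point_process Theta /\
  forall t : R, 0 < t ->
    (\int[P]_w pf_counting (Theta w) (`]0%R, t] `*` setT) < +oo)%E.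

Definition hitting_times (R : realType) dO (Omega : measurableType dO)
    (P : probability Omega R) dZ (Z : measurableType dZ)
    (Theta : Omega -> point_function R Z) (alpha : nat -> Omega -> R) :=
  [/\ forall w, alpha 0%N w = 0,
      forall m, (0 < m)%N ->
        measurable_fun setT (alpha m) /\ forall w, 0 < alpha m w &
      {ae P, forall w,
        pf_dom (Theta w) = [set alpha m w | m in [set m | (0 < m)%N]] /\
        forall m, alpha m w < alpha m.+1 w}].

Definition borel (T : ptopologicalType) := g_sigma_algebraType (@open T).

Definition separable (T : topologicalType) :=
  exists2 S : set T, countable S & dense S.

(* The maps on [0, oo) and (0, oo) are represented by maps on R of which only
   the restriction matters. *)
Definition measurable_process (R : realType) (V : completeNormedModType R)
    dO (Omega : measurableType dO) (X : R -> Omega -> V) :=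
  measurable_fun (`[0, +oo[ `*` setT : set (measurableTypeR R * Omega))
    (fun p : measurableTypeR R * Omega => X p.1 p.2 : borel V).

Definition measurable_mark (R : realType) (V : completeNormedModType R)
    dO (Omega : measurableType dO) dZ (Z : measurableType dZ)
    (eta : R -> Z -> Omega -> V) :=
  measurable_fun
    (`]0, +oo[ `*` setT `*` setT : set (measurableTypeR R * Z * Omega))
    (fun p : measurableTypeR R * Z * Omega =>
      eta p.1.1 p.1.2 p.2 : borel V).

Definition dual (R : realType) (V : normedModType R) : set {linear V -> R^o} :=
  [set Psi | continuous Psi].
Arguments dual {R} V.

Definition separates_points (R : realType) (V : normedModType R)
    (Vstar : set {linear V -> R^o}) :=
  forall v : V, (forall Psi, Vstar Psi -> Psi v = 0) -> v = 0.

Definition absolutely_continuous (R : realType) (V : normedModType R)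
    (a b : R) (f : R -> V) :=
  forall e : R, 0 < e -> exists2 d : R, 0 < d &
    forall (n : nat) (u v : 'I_n -> R),
      (forall i, [/\ a <= u i, u i <= v i & v i <= b]) ->
      trivIset setT (fun i => `]u i, v i[%classic) ->
      \sum_i (v i - u i) < d -> \sum_i `|f (v i) - f (u i)| < e.

Definition W11 (R : realType) (V : normedModType R) (a b : R) (f : R -> V) :=
  absolutely_continuous a b f /\
  {ae (@lebesgue_measure R), forall t, `]a, b[%classic t -> derivable f t 1}.

Definition cadlag (R : realType) (V : normedModType R) (f : R -> V) :=
  (forall t, 0 <= t -> f s @[s --> t^'+] --> f t) /\
  (forall t, 0 < t -> cvg (f s @[s --> t^'-])).

Section accretive_operators.
Context (R : realType) (V : normedModType R).
(* A v is the set of all v' with (v, v') in the graph. *)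
Implicit Type A : V -> set V.

Definition op_dom A : set V := [set v | A v !=set0].

Definition accretive A :=
  forall (a : R) (v1 v2 w1 w2 : V), 0 < a -> A v1 w1 -> A v2 w2 ->
    `|v1 - v2| <= `|v1 - v2 + a *: (w1 - w2)|.

Definition m_accretive A :=
  accretive A /\
  forall a : R, 0 < a -> forall y, exists v w, A v w /\ v + a *: w = y.

Definition densely_defined A := closure (op_dom A) = setT.

(* An implicit Euler scheme for 0 \in u' + A u on [0, T] of precision e: a
   partition 0 = t_0 < ... < t_N of mesh < e with T - e < t_N <= T, nodes
   u_0, ..., u_N and residuals f_1, ..., f_N of total mass < e such that
   f_i \in (u_i - u_(i-1)) / (t_i - t_(i-1)) + A u_i. *)
Definition euler_scheme A (T e : R) (N : nat) (t : nat -> R) (u : nat -> V) :=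
  [/\ t 0%N = 0,
      forall i, (i < N)%N -> 0 < t i.+1 - t i < e,
      T - e < t N <= T &
      exists2 f : nat -> V,
        \sum_(i < N) (t i.+1 - t i) * `|f i.+1| < e &
        forall i, (i < N)%N ->
          A (u i.+1) (f i.+1 - (t i.+1 - t i)^-1 *: (u i.+1 - u i))].

(* u is the mild solution of 0 \in u' + A u with u(0) = v: on every [0, T] it
   is the uniform limit of the step functions equal to u_0 at 0 and to u_i on
   ]t_(i-1), t_i]. *)
Definition acp_mild_solution A (v : V) (u : R -> V) :=
  [/\ u 0 = v,
      {within `[0, +oo[, continuous u} &
      forall T e : R, 0 < T -> 0 < e ->
        exists N t un, [/\ euler_scheme A T e N t un,
          `|u 0 - un 0%N| < e &
          forall i s, (i < N)%N -> t i < s <= t i.+1 ->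
            `|u s - un i.+1| < e]].

Definition associated_semigroup A (T : R -> V -> V) :=
  forall v, acp_mild_solution A v (fun t => T t v).

Definition domain_invariant A (T : R -> V -> V) :=
  forall t v, 0 < t -> op_dom A (T t v).

Definition infinitesimal_generator A (T : R -> V -> V) (A0 : V -> V) :=
  (forall v, op_dom A v ->
     - (h^-1 *: (T h v - v)) @[h --> 0^'+] --> A0 v /\ A v (A0 v)) /\
  (forall v, ~ op_dom A v -> A0 v = 0).

End accretive_operators.

Section acprm.
Context (R : realType) (V : completeNormedModType R).
Context dO (Omega : measurableType dO) (P : probability Omega R).
Context dZ (Z : measurableType dZ).
Variables (Theta : Omega -> point_function R Z) (alpha : nat -> Omega -> R).
Variables (A : V -> set V) (A0 : V -> V) (Vstar : set {linear V -> R^o}).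

Definition path_regularity (x : Omega -> V) (X : R -> Omega -> V) (w : Omega) :=
  [/\ X 0 w = x w,
      cadlag (X ^~ w),
      forall t, 0 < t -> (forall m, (0 < m)%N -> t <> alpha m w) ->
        op_dom A (X t w) &
      forall m a b, alpha m w < a -> a <= b -> b < alpha m.+1 w ->
        W11 a b (X ^~ w)].

Definition strong_solution (x : Omega -> V) (eta : R -> Z -> Omega -> V)
    (X : R -> Omega -> V) :=
  measurable_process X /\
  {ae P, forall w,
    [/\ path_regularity x X w,
        forall (t : R) Psi, 0 < t -> Vstar Psi ->
          (@lebesgue_measure R).-integrable `]0, t[
            (fun s => (Psi (A0 (X s w)) : R)%:E) &
        forall (t : R) Psi, 0 < t -> Vstar Psi ->
          Psi (X t w - x w) +
            \int[@lebesgue_measure R]_(s in `]0, t[) (Psi (A0 (X s w)) : R) =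
          \int[pf_counting (Theta w)]_(p in `]0, t] `*` setT)
            (Psi (eta p.1 p.2 w) : R)]}.

(* The supremum is taken in the extended reals, since the real-valued [sup] of
   an unbounded set is 0. *)
Definition mild_solution (x : Omega -> V) (eta : R -> Z -> Omega -> V)
    (Y : R -> Omega -> V) :=
  [/\ measurable_process Y,
      {ae P, forall w, path_regularity x Y w} &
      exists (xm : nat -> Omega -> V) (etam : nat -> R -> Z -> Omega -> V)
             (Xm : nat -> R -> Omega -> V),
        [/\ forall m, measurable_fun setT (xm m : Omega -> borel V),
            forall m, measurable_mark (etam m),
            forall m, strong_solution (xm m) (etam m) (Xm m) &
            {ae P, forall w, forall t : R, 0 < t ->
              ereal_sup [set `|Xm m s w - Y s w|%:E | s in `[0, t]]
                @[m --> \oo] --> 0%E /\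
              (\int[pf_counting (Theta w)]_(p in `]0%R, t] `*` setT)
                 `|etam m p.1 p.2 w - eta p.1 p.2 w|%:E)%E
                @[m --> \oo] --> 0%E}]].

End acprm.

Definition indistinguishable (R : realType) (V : completeNormedModType R)
    dO (Omega : measurableType dO) (P : probability Omega R)
    (X1 X2 : R -> Omega -> V) :=
  {ae P, forall w, forall t, 0 <= t -> X1 t w = X2 t w}.

(* Main.v *)
Require Import Defs.
From HB Require Import structures.
From mathcomp Require Import all_boot all_order all_algebra.
From mathcomp Require Import all_classical all_reals all_analysis.
From mathcomp Require Import measurable_realfun lra.
From mathcomp Require finmap.
Import Order.TTheory GRing.Theory Num.Theory.
Import numFieldNormedType.Exports.
Local Open Scope classical_set_scope.
Local Open Scope ring_scope.
Set Implicit Arguments.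
Unset Strict Implicit.
Unset Printing Implicit Defensive.

(* Two strong solutions driven by (x1, eta1) and (x2, eta2) satisfy, pathwise
   for alpha_n <= t < alpha_(n+1),
     |X1(t) - X2(t)| <= |x1 - x2| + \sum_(k <= n) |eta1 - eta2|(alpha_k, z_k),
   where z_k is the mark hit at alpha_k.  Between two hitting times the tested
   equation gives X' = - A0 X almost everywhere, so by accretivity the absolutely
   continuous function |X1 - X2| has nonpositive left Dini derivative almost
   everywhere and is nonincreasing; at a hitting time the tested equation forces
   X to jump by the mark.  Applied to the strong solutions approximating two mild
   solutions with the same data, the right-hand side tends to 0. *)

(** * Monotonicity of absolutely continuous functions from a one-sided derivative bound *)

(** The supremum is the variation of [f] on [[c, b]] carried by [U]. The left endpoint [c] is the
    one that will move, starting from [b]. *)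
Definition variations_in (R : realType) (f : R -> R^o) (U : set R) (b c : R) :
  set R := [set r | exists n (u v : 'I_n -> R),
    [/\ forall i, [/\ c <= u i, u i <= v i & v i <= b],
        trivIset setT (fun i => `]u i, v i[%classic),
        forall i, `]u i, v i[%classic `<=` U &
        r = \sum_i `|f (v i) - f (u i)|]].

Lemma variations_in0 (R : realType) (f : R -> R^o) U b c :
  variations_in f U b c 0.
Proof.
exists 0%N, (fun=> 0), (fun=> 0); split; [by case|by move=> []|by case|].
by rewrite big_ord0.
Qed.

Lemma sum_length_le (R : realType) (n : nat) (u v : 'I_n -> R) (U : set R) :
  measurable (U : set (measurableTypeR R)) ->
  (forall i, u i <= v i) -> trivIset setT (fun i => `]u i, v i[%classic) ->
  (forall i, `]u i, v i[%classic `<=` U) ->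
  ((\sum_i (v i - u i))%:E <= lebesgue_measure U)%E.
Proof.
move=> mU uv tuv uvU.
have -> : (\sum_i (v i - u i))%:E =
    (lebesgue_measure (\big[setU/set0]_(i < n) `]u i, v i[%classic))%E.
  rewrite measure_bigsetU_ord//= -sumEFin; apply: eq_bigr => i _.
  rewrite lebesgue_measure_itv /= lte_fin.
  by case: ltgtP (uv i) => //= -> _; rewrite subrr.
apply: le_measure; rewrite ?inE//.
  by apply: bigsetU_measurable => i _.
by apply: (big_ind (fun A => A `<=` U)) => // A B AU BU; rewrite subUset.
Qed.

(** Disjoint intervals inside [U] have total length below the threshold [d] of absolute
    continuity. *)
Lemma variations_in_le (R : realType) (f : R -> R^o) U a b c e d :
  measurable (U : set (measurableTypeR R)) -> (lebesgue_measure U < d%:E)%E ->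
  (forall (n : nat) (u v : 'I_n -> R),
      (forall i, [/\ a <= u i, u i <= v i & v i <= b]) ->
      trivIset setT (fun i => `]u i, v i[%classic) ->
      \sum_i (v i - u i) < d -> \sum_i `|f (v i) - f (u i)| < e) ->
  a <= c -> ubound (variations_in f U b c) e.
Proof.
move=> mU Ud ac_f ac _ [n [u [v [cuvb tuv uvU ->]]]]; apply/ltW/ac_f => //.
  by move=> i; have [? ? ?] := cuvb i; split => //; apply: le_trans ac _.
rewrite -lte_fin; apply: le_lt_trans Ud; apply: sum_length_le => // i.
by have [] := cuvb i.
Qed.

(** Prepending []s, c[] to a family in [[c, b]] keeps it disjoint, because every [u j] is at least
    [c]. *)
Lemma variations_in_sup_add (R : realType) (f : R -> R^o) U b c s :
  has_sup (variations_in f U b s) -> s <= c -> c <= b ->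
  `]s, c[%classic `<=` U ->
  sup (variations_in f U b c) + `|f c - f s| <= sup (variations_in f U b s).
Proof.
move=> hs sc cb scU; rewrite -lerBrDr; apply: ge_sup.
  by exists 0; exact: variations_in0.
move=> _ [n [u [v [cuvb tuv uvU ->]]]]; rewrite lerBrDr.
apply: ub_le_sup; first by case: hs.
pose ext (x : R) (w : 'I_n -> R) (i : 'I_n.+1) :=
  if unlift ord0 i is Some j then w j else x.
have ext0 x w : ext x w ord0 = x by rewrite /ext unlift_none.
have extS x w j : ext x w (lift ord0 j) = w j by rewrite /ext liftK.
have uc j : c <= u j by have [] := cuvb j.
have disj j : `]s, c[%classic `&` `]u j, v j[%classic = set0.
  apply/seteqP; split => // t [] /=; rewrite !in_itv /= => /andP[_ tc].
  by move=> /andP[ut _]; have := lt_trans ut tc; rewrite ltNge uc.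
exists n.+1, (ext s u), (ext c v); split.
- move=> i; case: (unliftP ord0 i) => [j ->|->]; rewrite !(ext0, extS)//.
  by have [? ? ?] := cuvb j; split => //; apply: le_trans sc _.
- apply/trivIsetP => i j _ _.
  case: (unliftP ord0 i) => [i' ->|->]; case: (unliftP ord0 j) => [j' ->|->];
    rewrite !(ext0, extS)//.
  + by rewrite (inj_eq lift_inj) => ij; move/trivIsetP: tuv; apply.
  + by move=> _; rewrite setIC disj.
- by move=> i; case: (unliftP ord0 i) => [j ->|->]; rewrite !(ext0, extS).
- rewrite big_ord_recl !ext0 addrC; congr (_ + _).
  by apply: eq_bigr => i _; rewrite !extS.
Qed.

(* Descending from [b]: over a small open [U] covering the exceptional null set
   the increments of [f] are charged to its variation inside [U], which absolute
   continuity bounds by [e]; elsewhere they are charged to [e * (b - c)]. *)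
Lemma ac_dini_le0 (R : realType) (a b : R) (f : R -> R^o) :
  a <= b -> absolutely_continuous a b f ->
  {ae (@lebesgue_measure R), forall t, `]a, b[%classic t ->
     forall e, 0 < e -> \forall s \near t^'-, f t - f s <= e * (t - s)} ->
  f b <= f a.
Proof.
move=> ab ac_f [N [mN N0 fN]].
suff H e : 0 < e -> f b - f a <= e * (b - a) + e.
  rewrite -subr_le0; apply/ler_addgt0Pl => e e0; rewrite addr0.
  have ba0 : 0 < b - a + 1 by rewrite ltr_wpDl// subr_ge0.
  (* With this value for both the slope and the mass, the two error terms add up to exactly [e]. *)
  have := H (e / (b - a + 1)); rewrite divr_gt0// => /(_ isT) /le_trans; apply.
  by rewrite -[X in _ + X]mulr1 -mulrDr divfK// gt_eqF.
move=> e0; have [d d0 acd] := ac_f e e0.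
(* With the endpoints included, a point of [[a, b]] outside [U] is interior and not exceptional, so
   the derivative bound applies to it. *)
pose N' : set R := N `|` [set a; b].
have mab : measurable ([set a; b] : set (measurableTypeR R)).
  by apply: measurableU; exact: measurable_set1.
have mN' : measurable (N' : set (measurableTypeR R)) by exact: measurableU.
have N'0 : lebesgue_measure N' = 0%E.
  apply/eqP; rewrite eq_le measure_ge0 andbT.
  apply: (le_trans (measureU2 _ mN mab)); rewrite [X in (X + _)%E]N0 add0e.
  by rewrite [X in (X <= _)%E]countable_lebesgue_measure0// finite_set_countable.
have [U [oU N'U]] : exists U : set R, [/\ open U, N' `<=` U &
    (lebesgue_measure U < d%:E)%E].
  have [|U [oU N'U Ud]] := lebesgue_regularity_outer mN' _ d0.
    by rewrite [X in (X < _)%E]N'0.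
  have mU : measurable (U : set (measurableTypeR R)) by exact: open_measurable.
  exists U; split => //; rewrite -(setDUK N'U).
  rewrite (le_lt_trans (measureU2 _ _ _))//; first exact: measurableD.
  by rewrite [X in (X + _)%E]N'0 add0e.
move=> Ud.
have mU : measurable (U : set (measurableTypeR R)) by exact: open_measurable.
pose W c := sup (variations_in f U b c).
have hW c : a <= c -> has_sup (variations_in f U b c).
  move=> ac; split; first by exists 0; exact: variations_in0.
  by exists e; exact: variations_in_le acd ac.
have We c : a <= c -> W c <= e.
  move=> ac; apply: ge_sup; first by exists 0; exact: variations_in0.
  exact: variations_in_le acd ac.
have W0 c : a <= c -> 0 <= W c.
  by move=> ac; apply: ub_le_sup; [case: (hW c ac)|exact: variations_in0].
have Wmono c c' : a <= c -> c <= c' -> W c' <= W c.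
  move=> ac cc'; apply: ge_sup; first by exists 0; exact: variations_in0.
  move=> r [n [u [v [cuvb tuv uvU ->]]]]; apply: ub_le_sup.
    by case: (hW c ac).
  exists n, u, v; split => // i; have [c'u ? ?] := cuvb i.
  by split => //; apply: le_trans c'u.
(* [S] collects the points from which the estimate up to [b] holds. Its infimum is shown to belong
   to [S], and then to equal [a]. *)
pose S := [set c | [/\ a <= c, c <= b & f b - f c <= e * (b - c) + W c]].
suff [_ _ Sa] : S a by apply: (le_trans Sa); rewrite lerD2l We.
have Sb : S b by split => //; rewrite !subrr mulr0 add0r W0.
have Slb : lbound S a by move=> c [].
have hS : has_inf S by split; [exists b|exists a].
set c := inf S.
have ac : a <= c by apply: lb_le_inf => //; exists b.
have cb : c <= b by apply: ge_inf => //; exists a.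
have Sc : f b - f c <= e * (b - c) + W c.
  (* If the estimate fails at [c] by a positive gap, absolute continuity on the single interval
     [[c, s]] with [s] in [S] close to [c] makes [f s - f c] smaller than the gap. Both [W] and
     [e * (b - _)] can only grow from [s] down to [c], a contradiction. *)
  rewrite leNgt; apply/negP => lt_c.
  have g0 : 0 < f b - f c - (e * (b - c) + W c) by rewrite subr_gt0.
  have [d' d'0 acd'] := ac_f _ g0.
  have [s Ss scd] : exists2 s, S s & s < c + d'.
    by have [s Ss sc] := inf_adherent d'0 hS; exists s.
  have cs : c <= s by apply: ge_inf => //; exists a.
  have [as_ sb Ss2] := Ss.
  have fsc : f s - f c < f b - f c - (e * (b - c) + W c).
    apply: le_lt_trans (ler_norm _) _.
    have := acd' 1%N (fun=> c) (fun=> s); rewrite !big_ord1; apply.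
    - by move=> _; split.
    - by apply/trivIsetP => i j _ _; rewrite (ord1 i) (ord1 j) eqxx.
    - by rewrite ltrBlDl.
  have := Wmono _ _ ac cs.
  have : e * (b - s) <= e * (b - c) by rewrite ler_pM2l// lerD2l lerN2.
  by move: Ss2 fsc; lra.
have {}Sc : S c by [].
have [->//|cna] := eqVneq a c.
have {cna}ac' : a < c by rewrite lt_neqAle cna.
(* If [a < c], a point [s < c] to which the estimate extends contradicts minimality of [c]. Inside
   [U] the increment is paid by [W s - W c], outside [U] by [e * (c - s)]. *)
suff [s [as_ sc Hs]] : exists s, [/\ a <= s, s < c &
    f c - f s + W c <= e * (c - s) + W s].
  have : S s.
    split => //; first exact: le_trans (ltW sc) cb.
    by case: Sc => _ _ ; move: Hs; lra.
  by move=> /(ge_inf (ex_intro _ a Slb)); rewrite -/c leNgt sc.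
have [Uc|nUc] := pselect (U c).
  have : \forall s \near c^'-, `]s, c[%classic `<=` U.
    have [r /= r0 rU] := oU _ Uc.
    near=> s => t /=; rewrite in_itv /= => /andP[st tc]; apply: rU => /=.
    rewrite ger0_norm ?subr_ge0 ?(ltW tc)// ltrBlDr -ltrBlDl.
    apply: lt_trans st; near: s; apply: nbhs_left_gt.
    by rewrite ltrBlDr ltrDl.
  move=> near_s.
  have [s [sU as_ sc]] : exists s, [/\ `]s, c[%classic `<=` U, a <= s & s < c].
    near (c^'-) => s; exists s; split; near: s => //.
      by apply: nbhs_left_ge.
    exact: nbhs_left_lt.
  exists s; split => //.
  have := variations_in_sup_add (hW s as_) (ltW sc) cb sU; rewrite -/(W c) -/(W s).
  have := ler_norm (f c - f s).
  have : 0 <= e * (c - s) by rewrite mulr_ge0// ?subr_ge0 ltW.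
  lra.
have abc : `]a, b[%classic c.
  rewrite /= in_itv /= ac' /= lt_neqAle cb andbT; apply/eqP => cb'.
  by apply: nUc; apply: N'U; right; right.
have nNc : ~ N c by move=> Nc; apply: nUc; apply: N'U; left.
have fc : \forall s \near c^'-, f c - f s <= e * (c - s).
  by apply: contrapT => H; apply: nNc; apply: fN => /(_ abc _ e0).
have [s [fcs as_ sc]] : exists s, [/\ f c - f s <= e * (c - s), a <= s & s < c].
  near (c^'-) => s; exists s; split; near: s => //.
    by apply: nbhs_left_ge.
  exact: nbhs_left_lt.
exists s; split => //; have := Wmono _ _ as_ (ltW sc); lra.
Unshelve. all: by end_near. Qed.

(** * Separability and the merging of null sets *)

Lemma separable_dense_sequence (R : realType) (V : normedModType R) :
  separable V ->
  exists q : nat -> V, forall v e, 0 < e -> exists k, `|v - q k| < e.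
Proof.
move=> [S cS dS]; have S0 : S !=set0.
  have [s [_ Ss]] := dS setT (ex_intro _ 0 I) openT; by exists s.
have [q Sq] : exists q : nat -> V, S `<=` range q.
  have [s Ss] := S0.
  move/countable_injP : cS => [g gi].
  (* Injectivity of [g] on [S] leaves at most one element with code [n]; a code that is not attained
     yields the default [s]. *)
  exists (fun n => xget s (S `&` (g @^-1` [set n]))) => t St.
  exists (g t) => //; case: xgetP => [u _ [Su /= gu]|/(_ t)]; last by case.
  by apply: gi; rewrite ?inE.
exists q => v e e0.
have [] := dS (ball v e); first by exists v; exact: ballxx.
  exact: ball_open.
move=> s [vs Ss]; have [k _ qk] := Sq _ Ss; exists k; rewrite qk.
by move: vs; rewrite -ball_normE.
Qed.

(* As [V] is Lindelof, countably many members of [Vstar] suffice to separate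
   points, so the exceptional null sets of uncountably many functionals can be
   merged. *)
Lemma ae_eq0_separates_points (R : realType) (V : normedModType R)
    (Vstar : set {linear V -> R^o}) d (T : measurableType d)
    (mu : {measure set T -> \bar R}) (E : set T) (f : T -> V) :
  separable V -> Vstar `<=` dual V -> separates_points Vstar ->
  (forall Psi, Vstar Psi -> {ae mu, forall t, E t -> Psi (f t) = 0}) ->
  {ae mu, forall t, E t -> f t = 0}.
Proof.
move=> /separable_dense_sequence[q qP] VV Vsep fE.
(* [nonvan k j] says that a single functional has no zero on the ball of centre [q k] and radius
   [1 / (j + 1)]. Hence the times of [E] at which [f] lies in that ball form a null set, and there
   are only countably many such balls. *)
pose nonvan k j := exists2 Psi, Vstar Psi &
  forall v, `|v - q k| < j.+1%:R^-1 -> Psi v != 0.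
pose B k j := [set t | [/\ E t, nonvan k j & `|f t - q k| < j.+1%:R^-1]].
have NB k j : mu.-negligible (B k j).
  have [[Psi VPsi Psi0]|nv] := pselect (nonvan k j); last first.
    by apply: (negligibleS _ (negligible_set0 mu)) => t [].
  apply: (negligibleS _ (fE _ VPsi)) => t [Et _ ft] /= H.
  by have := Psi0 _ ft; rewrite (H Et) eqxx.
apply: (@negligibleS _ _ _ _ (\bigcup_k \bigcup_j B k j)); last first.
  by apply: negligible_bigcup => k; exact: negligible_bigcup.
move=> t /= /not_implyP[Et ft0].
have [Psi VPsi Psift] : exists2 Psi, Vstar Psi & Psi (f t) != 0.
  apply: contrapT => H; apply: ft0; apply: Vsep => Psi VPsi.
  by apply: contrapT => /eqP Psift; apply: H; exists Psi.
have [e e0 eP] : exists2 e, 0 < e & forall v, `|f t - v| < e -> Psi v != 0.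
  have /cvgrPdist_lt/(_ `|Psi (f t)|) := VV _ VPsi (f t).
  rewrite normr_gt0 => /(_ Psift)/nbhs_normP[e /= e0 eP].
  exists e => // v /eP /=; apply: contraTneq => ->.
  by rewrite subr0 ltxx.
(* Half of [e] suffices: a ball of this radius whose centre is that close to [f t] lies in the ball
   of radius [e] around [f t]. *)
have [j je] : exists j, j.+1%:R^-1 < e / 2.
  have e20 : 0 < e / 2 by rewrite divr_gt0.
  exists (Num.truncn (e / 2)^-1); rewrite invf_plt ?posrE//.
  exact: truncnS_gt.
have [k kj] := qP (f t) j.+1%:R^-1 ltac:(by rewrite invr_gt0).
exists k => //; exists j => //; split => //; exists Psi => // v vq.
apply: eP; rewrite (le_lt_trans (ler_distD (q k) _ _))//.
by rewrite [e]splitr ltrD// ?(lt_trans kj)// distrC (lt_trans vq).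
Qed.

(** * Contraction along accretive evolutions *)

Lemma subrACA (V : zmodType) (x y u v : V) : x - y - (u - v) = x - u - (y - v).
Proof. by rewrite !opprB addrACA [RHS]addrACA (addrC (- y)). Qed.

Lemma absolutely_continuous_dist (R : realType) (V : normedModType R) (a b : R)
    (X1 X2 : R -> V) :
  absolutely_continuous a b X1 -> absolutely_continuous a b X2 ->
  absolutely_continuous a b (fun t => `|X1 t - X2 t| : R^o).
Proof.
move=> ac1 ac2 e e0; have e20 : 0 < e / 2 by rewrite divr_gt0.
have [d1 d10 ac1d] := ac1 _ e20; have [d2 d20 ac2d] := ac2 _ e20.
exists (Num.min d1 d2); first by rewrite lt_min d10.
move=> n u v uv tuv; rewrite lt_min => /andP[lt1 lt2].
rewrite [e]splitr.
apply: le_lt_trans (ltrD (ac1d n u v uv tuv lt1) (ac2d n u v uv tuv lt2)).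
rewrite -big_split; apply: ler_sum => i _ /=.
by rewrite (le_trans (ler_dist_dist _ _))// subrACA ler_normB.
Qed.

Lemma derivable_taylor1 (R : realType) (V : normedModType R) (f : R -> V)
    (t e : R) : derivable f t 1 -> 0 < e ->
  \forall s \near t, `|f s - f t - (s - t) *: 'D_1 f t| <= e * `|s - t|.
Proof.
move=> /cvgrPdist_le/(_ _) df e0.
have /nbhs_ballP[r /= r0 rP] := df _ e0.
near=> s; have [->|st] := eqVneq s t.
  by rewrite !subrr scale0r subr0 !normr0 mulr0.
have /rP : ball 0 r (s - t).
  rewrite /ball /= sub0r normrN; near: s.
  by exists r => //= s /=; rewrite distrC.
rewrite subr_eq0 => /(_ st); rewrite -[(s - t) *: 1]/((s - t) * 1) mulr1 subrK.
rewrite distrC => ets.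
have n0 : 0 < `|s - t| by rewrite normr_gt0 subr_eq0.
rewrite mulrC -ler_pdivrMl// -normfV -normrZ scalerBr scalerA mulVf ?subr_eq0//.
by rewrite scale1r.
Unshelve. all: by end_near. Qed.

(** The backward step [X t - (t - s) X'(t)] equals [X s] up to a small multiple of [t - s].
    Accretivity with step [t - s] therefore bounds the distance at [t] by the distance at [s] plus
    such an error, which is the hypothesis of [ac_dini_le0]. *)
Lemma accretive_contraction (R : realType) (V : normedModType R) (A : V -> set V)
    (a b : R) (X1 X2 : R -> V) :
  accretive A -> a <= b ->
  absolutely_continuous a b X1 -> absolutely_continuous a b X2 ->
  {ae (@lebesgue_measure R), forall t, `]a, b[%classic t ->
    derivable X1 t 1 /\ A (X1 t) (- 'D_1 X1 t)} ->
  {ae (@lebesgue_measure R), forall t, `]a, b[%classic t ->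
    derivable X2 t 1 /\ A (X2 t) (- 'D_1 X2 t)} ->
  `|X1 b - X2 b| <= `|X1 a - X2 a|.
Proof.
move=> accA ab ac1 ac2 ae1 ae2.
apply: (ac_dini_le0 ab (absolutely_continuous_dist ac1 ac2)).
have F := ae_filter_ringOfSetsType (@lebesgue_measure R).
apply: filterS2 ae1 ae2 => t H1 H2 abt e e0.
have [{}H1 A1] := H1 abt; have [{}H2 A2] := H2 abt.
have e20 : 0 < e / 2 by rewrite divr_gt0.
have T1 : \forall s \near t^'-,
    `|X1 s - X1 t - (s - t) *: 'D_1 X1 t| <= e / 2 * `|s - t|.
  by apply: cvg_within; exact: derivable_taylor1.
have T2 : \forall s \near t^'-,
    `|X2 s - X2 t - (s - t) *: 'D_1 X2 t| <= e / 2 * `|s - t|.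
  by apply: cvg_within; exact: derivable_taylor1.
near=> s.
have st : s < t by near: s; exact: nbhs_left_lt.
have h0 : 0 < t - s by rewrite subr_gt0.
have B1 : `|X1 s - X1 t - (s - t) *: 'D_1 X1 t| <= e / 2 * `|s - t|.
  by near: s.
have B2 : `|X2 s - X2 t - (s - t) *: 'D_1 X2 t| <= e / 2 * `|s - t|.
  by near: s.
rewrite lerBlDr (le_trans (accA _ _ _ _ _ h0 A1 A2))//.
(* [p X] is the first-order Taylor remainder at [t]; the two remainders share the error
   [e * (t - s)] equally. *)
pose p (X : R -> V) := X s - X t - (s - t) *: 'D_1 X t.
rewrite (_ : X1 t - X2 t + _ = (X1 s - X2 s) - (p X1 - p X2)); last first.
  have pE X : p X = X s - (X t - (t - s) *: 'D_1 X t).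
    by rewrite /p opprB addrA addrAC -(opprB t) scaleNr opprK.
  rewrite !pE -(subrACA (X1 s) (X2 s)) subKr [RHS]subrACA; congr (_ + _).
  by rewrite scalerBr !scalerN opprK opprB addrC.
rewrite (le_trans (ler_normB _ _))// addrC lerD2r (le_trans (ler_normB _ _))//.
by rewrite (le_trans (lerD B1 B2))// -mulrDl -splitr distrC gtr0_norm.
Unshelve. all: by end_near. Qed.

(** * Integrals against the counting measure along the hitting times *)

Lemma integral_pf_counting_empty (R : realType) dZ (Z : measurableType dZ)
    (theta : point_function R Z) (D : set (measurableTypeR R * Z))
    (f : measurableTypeR R * Z -> \bar R) :
  pf_points theta D = set0 -> (\int[pf_counting theta]_(p in D) f p = 0)%E.
Proof.
move=> D0; rewrite (eq_measure_integral mzero); first exact: integral_measure_zero.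
move=> A mA AD; rewrite /= /pf_counting (_ : pf_points theta A = set0).
  by rewrite /counting asboolT// fset_set0.
by rewrite -subset0 -D0 => r [z rz Az]; exists z => //; exact: AD.
Qed.

(** A measurable subset of [D] has mass one or zero according to whether it contains [(t, z)], so on
    [D] the counting measure is a Dirac mass. *)
Lemma integral_pf_counting_singleton (R : realType) dZ (Z : measurableType dZ)
    (theta : point_function R Z) (D : set (measurableTypeR R * Z))
    (f : measurableTypeR R * Z -> \bar R) (t : R) (z : Z) :
  measurable D -> measurable_fun D f ->
  theta t = Some z -> pf_points theta D = [set t] ->
  (\int[pf_counting theta]_(p in D) f p = f (t, z))%E.
Proof.
move=> mD mf tz Dt.
have Dtz : D (t, z).
  have : pf_points theta D t by rewrite Dt.
  by move=> [z']; rewrite tz => -[->].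
rewrite (eq_measure_integral (\d_((t, z) : measurableTypeR R * Z))); last first.
  move=> A mA AD; rewrite /= /pf_counting diracE.
  have At r : pf_points theta A r -> r = t.
    move=> [z' rz' Az']; have : pf_points theta D r by exists z' => //; exact: AD.
    by rewrite Dt.
  have [Atz|nAtz] := pselect (A (t, z)).
    rewrite mem_set// (_ : pf_points theta A = [set t]).
      by rewrite /counting asboolT// fset_set1 finmap.cardfs1.
    by apply/seteqP; split => [r /At//|_ ->]; exists z.
  rewrite memNset// (_ : pf_points theta A = set0).
    by rewrite /counting asboolT// fset_set0.
  rewrite -subset0 => r Ar; have rt := At _ Ar; subst r.
  by move: Ar => [z']; rewrite tz => -[<-].
by rewrite integral_dirac// diracE mem_set// mul1e.
Qed.

Definition mark_strip (R : realType) dZ (Z : measurableType dZ) (s t : R) :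
  set (measurableTypeR R * Z) := `]s, t] `*` setT.

Lemma measurable_mark_strip (R : realType) dZ (Z : measurableType dZ) (s t : R) :
  measurable (@mark_strip R dZ Z s t).
Proof. exact: measurableX. Qed.

Lemma mark_stripU (R : realType) dZ (Z : measurableType dZ) (s t u : R) :
  s <= t -> t <= u ->
  @mark_strip R dZ Z s u = mark_strip s t `|` mark_strip t u.
Proof.
move=> st tu; rewrite /mark_strip (@itv_bndbnd_setU _ _ _ (BRight t))//.
by apply/seteqP; split => -[r z]; [move=> [[rs|rs] _]; [left|right]|
  move=> [] [rs _]; split => //; [left|right]].
Qed.

Lemma mark_strip_disjoint (R : realType) dZ (Z : measurableType dZ) (s t u : R) :
  [disjoint (@mark_strip R dZ Z s t) & mark_strip t u].
Proof.
apply/disj_setPS => -[r z] [[/=]]; rewrite !in_itv /= => /andP[_ rt] _ [/=].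
by rewrite in_itv /= ltNge rt.
Qed.

(** The pathwise form of [hitting_times], with the marks made explicit. The index shift reflects
    that [al 0 = 0] is not a hit: [z m] is the mark at [al m.+1]. *)
Definition hits_at (R : realType) dZ (Z : measurableType dZ)
    (theta : point_function R Z) (al : nat -> R) (z : nat -> Z) :=
  [/\ al 0%N = 0, forall m, al m < al m.+1,
      pf_dom theta = [set al m | m in [set m | (0 < m)%N]] &
      forall m, theta (al m.+1) = Some (z m)].

Lemma hits_lt (R : realType) dZ (Z : measurableType dZ)
    (theta : point_function R Z) al z m n :
  hits_at theta al z -> (al m < al n) = (m < n)%N.
Proof.
by move=> [_ /increasing_seqP incr _ _]; rewrite ltNge incr ltnNge.
Qed.

Lemma hits_strip_empty (R : realType) dZ (Z : measurableType dZ)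
    (theta : point_function R Z) al z n (s t : R) :
  hits_at theta al z -> al n <= s -> t < al n.+1 ->
  pf_points theta (mark_strip s t) = set0.
Proof.
move=> hits ns tn; have [_ _ dom _] := hits.
rewrite -subset0 => r [z' rz' [/=]]; rewrite in_itv /= => /andP[sr rt] _.
have : pf_dom theta r by rewrite /pf_dom /= rz'.
rewrite dom => -[m _ mr]; rewrite -mr in sr rt.
have : al n < al m by apply: le_lt_trans sr.
have : al m < al n.+1 by apply: le_lt_trans tn.
by rewrite !(hits_lt _ _ hits) ltnS ltnNge => ->.
Qed.

Lemma hits_strip_singleton (R : realType) dZ (Z : measurableType dZ)
    (theta : point_function R Z) al z n (s : R) :
  hits_at theta al z -> al n <= s -> s < al n.+1 ->
  pf_points theta (mark_strip s (al n.+1)) = [set al n.+1].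
Proof.
move=> hits ns sn; have [_ _ dom zE] := hits.
apply/seteqP; split => [r [z' rz' [/=]]|_ ->]; last first.
  by exists (z n) => //; split => //=; rewrite in_itv /= sn lexx.
rewrite in_itv /= => /andP[sr rt] _.
have : pf_dom theta r by rewrite /pf_dom /= rz'.
rewrite dom => -[m _ mr]; rewrite -mr in sr rt *.
have : al n < al m by apply: le_lt_trans sr.
move: rt.
rewrite leNgt !(hits_lt _ _ hits) -leqNgt => mn nm; congr (al _).
by apply/eqP; rewrite eqn_leq mn.
Qed.

Section integral_along_hits.
Context (R : realType) dZ (Z : measurableType dZ) (theta : point_function R Z).
Context (al : nat -> R) (z : nat -> Z) (h : measurableTypeR R * Z -> R).
Hypothesis hits : hits_at theta al z.
Hypothesis mh : forall t, measurable_fun (mark_strip 0 t) h.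

Let J t := \int[pf_counting theta]_(p in mark_strip 0 t) h p.

Lemma hits_ge0 n : 0 <= al n.
Proof.
case: hits => al0 lt_al _ _; elim: n => [|n IH]; first by rewrite al0.
exact: le_trans IH (ltW (lt_al n)).
Qed.

Let mhs s t : 0 <= s -> measurable_fun (mark_strip s t) h.
Proof.
move=> s0; apply: (measurable_funS _ _ (@mh t)); first exact: measurable_mark_strip.
move=> [r w] [/=]; rewrite in_itv /= => /andP[sr rt] _; split => //=.
by rewrite in_itv /= rt (le_lt_trans s0).
Qed.

(** Splitting a real-valued integral over adjacent strips requires integrability. It is assembled
    from strips without a hit, where the integral vanishes, and strips with a single hit, where it
    is one finite value. *)
Let int_none n s t : al n <= s -> t < al n.+1 ->
  (pf_counting theta).-integrable (mark_strip s t) (EFin \o h).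
Proof.
move=> ns tn; apply/integrableP; split.
  by apply/measurable_EFinP; apply: mhs; exact: le_trans (hits_ge0 n) ns.
by rewrite integral_pf_counting_empty ?ltry//; exact: hits_strip_empty hits ns tn.
Qed.

Let int_one n s : al n <= s -> s < al n.+1 ->
  (pf_counting theta).-integrable (mark_strip s (al n.+1)) (EFin \o h).
Proof.
move=> ns sn; have mhs1 := @mhs s (al n.+1) (le_trans (hits_ge0 n) ns).
apply/integrableP; split; first exact/measurable_EFinP.
have [_ _ _ /(_ n) zn] := hits.
rewrite (integral_pf_counting_singleton _ _ zn) ?ltry//.
- exact: measurable_mark_strip.
- by apply: measurableT_comp => //; exact/measurable_EFinP.
- exact: hits_strip_singleton hits ns sn.
Qed.

Let int_glue s t : 0 <= s -> s <= t ->
  (pf_counting theta).-integrable (mark_strip 0 s) (EFin \o h) ->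
  (pf_counting theta).-integrable (mark_strip s t) (EFin \o h) ->
  (pf_counting theta).-integrable (mark_strip 0 t) (EFin \o h).
Proof.
move=> s0 st /integrableP[_ i1] /integrableP[_ i2]; apply/integrableP; split.
  exact/measurable_EFinP.
have mn : measurable_fun (mark_strip 0 t) (fun x => `|(EFin \o h) x|%E).
  by apply: measurableT_comp => //; exact/measurable_EFinP.
move: mn; rewrite (mark_stripU _ s0 st) => mn.
rewrite ge0_integral_setU//; [|exact: measurable_mark_strip..
  |exact: mark_strip_disjoint].
by rewrite lte_add_pinfty.
Qed.

Let int_al n : (pf_counting theta).-integrable (mark_strip 0 (al n)) (EFin \o h).
Proof.
have [al0 lt_al _ _] := hits; elim: n => [|n IH].
  by rewrite al0; apply: (@int_none 0%N); rewrite ?al0// -[ltLHS]al0.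
apply: int_glue IH _ => //; [exact: hits_ge0|exact: ltW|].
exact: int_one.
Qed.

Lemma integral_hits_const n s t : al n <= s -> s <= t -> t < al n.+1 -> J t = J s.
Proof.
move=> ns st tn; rewrite /J (mark_stripU _ (le_trans (hits_ge0 n) ns) st).
rewrite Rintegral_setU; [|exact: measurable_mark_strip..| |exact: mark_strip_disjoint].
  rewrite [X in _ + X = _]/Rintegral integral_pf_counting_empty ?addr0//.
  exact: hits_strip_empty hits ns tn.
rewrite -mark_stripU// ?(le_trans (hits_ge0 n) ns)//.
apply: (@int_glue (al n)) => //; [exact: hits_ge0|exact: le_trans ns st|].
exact: int_none.
Qed.

Lemma integral_hits_jump n s : al n <= s -> s < al n.+1 ->
  J (al n.+1) = J s + h (al n.+1, z n).
Proof.
move=> ns sn; have s0 := le_trans (hits_ge0 n) ns.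
rewrite /J (mark_stripU _ s0 (ltW sn)).
rewrite Rintegral_setU; [|exact: measurable_mark_strip..| |exact: mark_strip_disjoint].
  congr (_ + _); rewrite /Rintegral.
  have [_ _ _ /(_ n) zn] := hits.
  rewrite (integral_pf_counting_singleton _ _ zn) //.
  - exact: measurable_mark_strip.
  - by apply/measurable_EFinP; exact: mhs.
  - exact: hits_strip_singleton hits ns sn.
by rewrite -mark_stripU// ?ltW.
Qed.

End integral_along_hits.

(** * The Lebesgue integral as a function of its upper endpoint *)

(** The fundamental theorem of calculus and left continuity are applied to integrals over [[0, y]];
    extending [g] by zero off []0, u[] transfers them to the open intervals of the tested
    equation. *)
Lemma Rintegral_itvoo_restrict (R : realType) (g : R -> R) (u y : R) :
  (@lebesgue_measure R).-integrable `]0, u[ (EFin \o g) -> 0 <= y -> y <= u ->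
  \int[@lebesgue_measure R]_(s in `[0, y]) (g \_ `]0, u[) s =
  \int[@lebesgue_measure R]_(s in `]0, y[) g s.
Proof.
move=> ig y0 yu.
have sub : `]0, y[ `<=` (`]0, u[ : set R).
  by apply: subset_itvl; rewrite bnd_simp.
transitivity (\int[@lebesgue_measure R]_(s in `]0, y[) (g \_ `]0, u[) s).
  rewrite /Rintegral integral_itv_bndoo//; apply/measurable_EFinP.
  have /integrableP[/measurable_EFinP mg _] := ig.
  refine ((measurable_restrict g _ _).1 _) => //.
  by apply: measurable_funS mg => // s [].
apply: eq_Rintegral => s /set_mem /sub us.
by rewrite patchE mem_set.
Qed.

Lemma integrable_restrict_itvoo (R : realType) (g : R -> R) (u : R) (E : set R) :
  measurable (E : set (measurableTypeR R)) ->
  (@lebesgue_measure R).-integrable `]0, u[ (EFin \o g) ->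
  (@lebesgue_measure R).-integrable E (EFin \o (g \_ `]0, u[)).
Proof.
move=> mE ig; rewrite -restrict_EFin; apply/integrable_restrict => //.
by refine (integrableS _ _ _ ig) => //; exact: measurableI.
Qed.

Lemma ae_derivable_integral_itvoo (R : realType) (g : R -> R) (u : R) :
  (@lebesgue_measure R).-integrable `]0, u[ (EFin \o g) ->
  {ae (@lebesgue_measure R), forall t, `]0, u[%classic t ->
    let G y := \int[@lebesgue_measure R]_(s in `]0, y[) g s in
    derivable (G : R -> R^o) t 1 /\ 'D_1 (G : R -> R^o) t = g t}.
Proof.
move=> ig.
have F := ae_filter_ringOfSetsType (@lebesgue_measure R).
pose G0 (y : R) := \int[@lebesgue_measure R]_(s in `[0, y]) (g \_ `]0, u[) s.
have H := @FTC1 R (g \_ `]0, u[) (BLeft 0)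
  (fun y => integrable_restrict_itvoo (measurable_itv _) ig)
  (integrable_locally (measurable_itv _) ig).
apply: filterS H => t + /[dup] t0u; rewrite /= in_itv /= => + /andP[t0 tu].
rewrite lte_fin t0 => /(_ isT)[dF DF].
have FG : \forall y \near t,
    G0 y = \int[@lebesgue_measure R]_(s in `]0, y[) g s.
  near=> y; apply: Rintegral_itvoo_restrict => //.
    by apply/ltW; near: y; exact: lt_nbhsr.
  by apply/ltW; near: y; exact: lt_nbhsl.
split; first exact: (near_eq_derivable FG dF).
rewrite -(near_eq_derive _ FG) -derive1E DF patchE mem_set//.
Unshelve. all: by end_near. Qed.

Lemma cvg_integral_itvoo_left (R : realType) (g : R -> R) (u : R) :
  0 < u -> (@lebesgue_measure R).-integrable `]0, u[ (EFin \o g) ->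
  \int[@lebesgue_measure R]_(s in `]0, y[) g s @[y --> u^'-] -->
  \int[@lebesgue_measure R]_(s in `]0, u[) g s.
Proof.
move=> u0 ig.
have ig' := @integrable_restrict_itvoo _ g u `[0, u] (measurable_itv _) ig.
have := parameterized_integral_cvg_at_left u0 ig'.
rewrite /parameterized_integral (Rintegral_itvoo_restrict ig)// ?ltW//.
apply: cvg_trans; apply: near_eq_cvg; near=> y.
have y0 : 0 <= y by near: y; exact: nbhs_left_ge.
have yu : y <= u by near: y; exact: nbhs_left_le.
exact: Rintegral_itvoo_restrict.
Unshelve. all: by end_near. Qed.

(** * Strong solutions along a single path: evolution between hits and jumps at hits *)

Lemma derive_linear_comp (R : realType) (V : normedModType R)
    (Psi : {linear V -> R^o}) (X : R -> V) (t : R) :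
  continuous Psi -> derivable X t 1 ->
  'D_1 (Psi \o X : R -> R^o) t = Psi ('D_1 X t).
Proof.
move=> cPsi dX; apply: cvg_lim => //.
have -> : (fun h : R => h^-1 *: ((Psi \o X) (h *: 1 + t) - (Psi \o X) t) : R^o) =
    Psi \o (fun h : R => h^-1 *: (X (h *: 1 + t) - X t)).
  by apply/funext => h /=; rewrite [RHS]linearZ_LR (linearB Psi).
by apply: cvg_comp; [exact: dX|exact: cPsi].
Qed.

Lemma measurable_continuous_comp (R : realType) (V : completeNormedModType R)
    d (T : measurableType d) (D : set T) (h : T -> V) (phi : V -> R) :
  continuous phi -> measurable_fun D (h : _ -> borel V) ->
  measurable_fun D (phi \o h).
Proof.
move=> cphi mh.
apply: (@measurableT_comp _ _ _ _ (borel V) _ (phi : borel V -> R)) mh.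
apply: (measurability _ (RGenOpens.measurableE R)) => _ [_ [a [b ->]] <-].
rewrite setTI; apply: sub_sigma_algebra.
exact: (open_comp (fun x _ => cphi x) (interval_open _ _)).
Qed.

Section strong_paths.
Context (R : realType) (V : completeNormedModType R) dZ (Z : measurableType dZ).
Variables (theta : point_function R Z) (al : nat -> R) (z : nat -> Z).
Variables (A : V -> set V) (A0 : V -> V) (Vstar : set {linear V -> R^o}).
Hypotheses (hits : hits_at theta al z) (Vsep : separable V).
Hypotheses (Vstar_dual : Vstar `<=` dual V) (Vstar_sep : separates_points Vstar).
Hypothesis A0A : forall v, op_dom A v -> A v (A0 v).

(** [regular_path] and [strong_path] are [path_regularity] and [strong_solution] for a frozen
    outcome. The initial value becomes [X 0], and measurability of the section of the mark is
    recorded alongside. *)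
Definition regular_path (X : R -> V) :=
  [/\ cadlag X,
      forall t, 0 < t -> (forall m, (0 < m)%N -> t <> al m) -> op_dom A (X t) &
      forall m a b, al m < a -> a <= b -> b < al m.+1 -> W11 a b X].

Definition strong_path (h : measurableTypeR R * Z -> V) (X : R -> V) :=
  [/\ regular_path X,
      forall t, measurable_fun (mark_strip 0 t) (h : _ -> borel V),
      forall (t : R) Psi, 0 < t -> Vstar Psi ->
          (@lebesgue_measure R).-integrable `]0, t[
            (fun s => (Psi (A0 (X s)) : R)%:E) &
      forall (t : R) Psi, 0 < t -> Vstar Psi ->
          Psi (X t - X 0) +
            \int[@lebesgue_measure R]_(s in `]0, t[) (Psi (A0 (X s)) : R) =
          \int[pf_counting theta]_(p in `]0, t] `*` setT) (Psi (h p) : R)].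

Variables (h : measurableTypeR R * Z -> V) (X : R -> V).
Hypothesis HX : strong_path h X.

Let G (Psi : {linear V -> R^o}) y :=
  \int[@lebesgue_measure R]_(s in `]0, y[) (Psi (A0 (X s)) : R).

Let P (Psi : {linear V -> R^o}) (y : R) : R := Psi (X y).

(** All terms vanish at [t = 0], so the tested equation is also available there, in particular at
    [al 0]. *)
Lemma strong_pathE t Psi : 0 <= t -> Vstar Psi ->
  P Psi t - P Psi 0 + G Psi t =
  \int[pf_counting theta]_(p in mark_strip 0 t) (Psi (h p) : R).
Proof.
move=> t0 VPsi; have -> : P Psi t - P Psi 0 = Psi (X t - X 0).
  by rewrite /P (linearB Psi).
move: t0; case: HX => _ _ _ idX; rewrite le_eqVlt => /predU1P[<-|t0]; last exact: idX.
rewrite subrr linear0 add0r /G /mark_strip set_itvoo0 Rintegral_set0.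
by rewrite set_itvoc0 set0X Rintegral_set0.
Qed.

(** No hit lies in []s, t]], so the mark integrals at [s] and [t] cancel when the tested equations
    are subtracted. *)
Lemma strong_path_increment n s t Psi : al n <= s -> s <= t -> t < al n.+1 ->
  Vstar Psi -> P Psi t - P Psi s = - (G Psi t - G Psi s).
Proof.
move=> ns st tn VPsi; have s0 := le_trans (hits_ge0 hits n) ns.
have [_ mh _ _] := HX.
have := integral_hits_const hits
  (fun t => measurable_continuous_comp (Vstar_dual VPsi) (@mh t)) ns st tn.
rewrite -!strong_pathE// ?(le_trans s0)//; lra.
Qed.

(** Near [t], [Psi] of [X] is a constant minus [G Psi], which has derivative [Psi (A0 (X t))] almost
    everywhere. The exceptional null set depends on [Psi]; [ae_eq0_separates_points] replaces it by
    one null set for the vector identity. *)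
Lemma strong_path_derive n a b : al n <= a -> b <= al n.+1 ->
  {ae (@lebesgue_measure R), forall t, `]a, b[%classic t /\ derivable X t 1 ->
     'D_1 X t + A0 (X t) = 0}.
Proof.
move=> na bn; apply: (ae_eq0_separates_points Vsep Vstar_dual Vstar_sep).
move=> Psi VPsi; have [_ _ igX _] := HX.
have F := ae_filter_ringOfSetsType (@lebesgue_measure R).
have u0 : 0 < al n.+1.
  by case: hits => _ lt_al _ _; exact: le_lt_trans (hits_ge0 hits n) (lt_al n).
apply: filterS (ae_derivable_integral_itvoo (igX _ _ u0 VPsi)) => t.
rewrite /= in_itv /= => H [/andP[at_ tb] dX].
have nt : al n < t by apply: le_lt_trans at_.
have tn : t < al n.+1 by apply: lt_le_trans bn.
have {H}[|dG DG] := H; first by rewrite tn andbT (le_lt_trans (hits_ge0 hits n)).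
rewrite linearD -derive_linear_comp//; last exact: Vstar_dual.
have near_eq : \forall s \near t,
    (Psi \o X : R -> R^o) s = (P Psi t + G Psi t - G Psi s : R^o).
  near=> s; rewrite -[LHS]/(P Psi s).
  have ns : al n < s by near: s; exact: lt_nbhsr.
  have sn : s < al n.+1 by near: s; exact: lt_nbhsl.
  have [st|/ltW ts] := leP s t.
    have := strong_path_increment (ltW ns) st tn VPsi; lra.
  have := strong_path_increment (ltW nt) ts sn VPsi; lra.
rewrite (near_eq_derive _ near_eq) deriveB//=.
by rewrite derive_cst sub0r DG addNr.
Unshelve. all: by end_near. Qed.

(** No hitting time lies strictly between [al n] and [al n.+1], so [X t] is in the domain there and
    [A0 (X t)] is a genuine value of [A]. *)
Lemma strong_path_ae_inclusion n a b : al n < a -> a <= b -> b < al n.+1 ->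
  {ae (@lebesgue_measure R), forall t, `]a, b[%classic t ->
    derivable X t 1 /\ A (X t) (- 'D_1 X t)}.
Proof.
move=> na ab bn; have [[_ domX WX] _ _ _] := HX.
have F := ae_filter_ringOfSetsType (@lebesgue_measure R).
have [_ dX] := WX _ _ _ na ab bn.
apply: filterS2 dX (strong_path_derive (ltW na) (ltW bn)) => t dX DX abt.
have {}dX := dX abt; split => //.
have /eqP := DX (conj abt dX); rewrite addr_eq0 => /eqP ->; rewrite opprK.
move: abt; rewrite /= in_itv /= => /andP[at_ tb].
have nt := lt_trans na at_; have tn := lt_trans tb bn.
apply/A0A/domX; first exact: le_lt_trans (hits_ge0 hits n) nt.
move=> m _ tm; rewrite tm in nt tn.
by move: nt tn; rewrite !(hits_lt _ _ hits) ltnS ltnNge => /negP.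
Qed.

(** The drift integral is left continuous, so only the mark survives when the tested equation at
    [al n.+1] is compared with its left limit. Separation of points then removes the functional. *)
Lemma strong_path_jump n (L : V) : X s @[s --> (al n.+1)^'-] --> L ->
  X (al n.+1) - L = h (al n.+1, z n).
Proof.
move=> XL; apply/eqP; rewrite -subr_eq0; apply/eqP; apply: Vstar_sep => Psi VPsi.
have [_ mh igX _] := HX; have [_ lt_al _ _] := hits.
have u0 : 0 < al n.+1 := le_lt_trans (hits_ge0 hits n) (lt_al n).
have cG : G Psi s @[s --> (al n.+1)^'-] --> G Psi (al n.+1).
  by apply: cvg_integral_itvoo_left => //; exact: igX.
have cPsi : P Psi s @[s --> (al n.+1)^'-] --> (Psi L : R).
  by apply: cvg_comp XL _; exact: Vstar_dual.
(* Just before the hit, the tested equation and [integral_hits_jump] force [G Psi s + P Psi s] to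
   take this value exactly; its left limit then yields the jump. *)
pose c : R := P Psi (al n.+1) + G Psi (al n.+1) - Psi (h (al n.+1, z n)).
have near_eq : \forall s \near (al n.+1)^'-, G Psi s + P Psi s = c.
  near=> s.
  have ns : al n <= s by near: s; exact: nbhs_left_ge.
  have sn : s < al n.+1 by near: s; exact: nbhs_left_lt.
  have s0 := le_trans (hits_ge0 hits n) ns.
  have := integral_hits_jump hits
    (fun t => measurable_continuous_comp (Vstar_dual VPsi) (@mh t)) ns sn.
  rewrite -!strong_pathE// ?(ltW u0)// /c; lra.
have cc : G Psi (al n.+1) + (Psi L : R) = c.
  have H : G Psi s + P Psi s @[s --> (al n.+1)^'-] --> G Psi (al n.+1) + (Psi L : R).
    exact: cvgD.
  rewrite -(cvg_lim (@Rhausdorff R) H).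
  apply: cvg_lim => //; apply: cvg_trans (cvg_cst c).
    by apply: near_eq_cvg; near=> s; apply/esym; near: s; exact: near_eq.
  exact: at_left_proper_filter.
rewrite !(linearB Psi); have : P Psi (al n.+1) - Psi L - Psi (h (al n.+1, z n)) = 0.
  by move: cc; rewrite /c; lra.
exact.
Unshelve. all: by end_near. Qed.

End strong_paths.

(** * The pathwise estimate across finitely many hits *)

Lemma strong_path_contraction (R : realType) (V : completeNormedModType R)
    dZ (Z : measurableType dZ) (theta : point_function R Z) (al : nat -> R)
    (z : nat -> Z) (A : V -> set V) (A0 : V -> V) (Vstar : set {linear V -> R^o})
    (h1 h2 : measurableTypeR R * Z -> V) (X1 X2 : R -> V) n t :
  hits_at theta al z -> separable V ->
  Vstar `<=` dual V -> separates_points Vstar ->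
  accretive A -> (forall v, op_dom A v -> A v (A0 v)) ->
  strong_path theta al A A0 Vstar h1 X1 -> strong_path theta al A A0 Vstar h2 X2 ->
  al n <= t -> t < al n.+1 ->
  `|X1 t - X2 t| <= `|X1 0 - X2 0| +
    \sum_(i < n) `|h1 (al i.+1, z i) - h2 (al i.+1, z i)|.
Proof.
move=> hits Vsep Vdual Vst accA A0A H1 H2.
have [al0 lt_al _ _] := hits.
have [[[rc1 lc1] _ W1] _ _ _] := H1; have [[[rc2 lc2] _ W2] _ _ _] := H2.
(* Absolute continuity is given only on compact intervals strictly between two hits; [outer] then
   reaches the left endpoint by right continuity. *)
have inner m s r : al m < s -> s <= r -> r < al m.+1 ->
    `|X1 r - X2 r| <= `|X1 s - X2 s|.
  move=> ms sr rm; apply: (accretive_contraction accA sr).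
  - by have [] := W1 _ _ _ ms sr rm.
  - by have [] := W2 _ _ _ ms sr rm.
  - exact: (strong_path_ae_inclusion hits Vsep Vdual Vst A0A H1 ms sr rm).
  - exact: (strong_path_ae_inclusion hits Vsep Vdual Vst A0A H2 ms sr rm).
have outer m r : al m <= r -> r < al m.+1 ->
    `|X1 r - X2 r| <= `|X1 (al m) - X2 (al m)|.
  rewrite le_eqVlt => /predU1P[->//|mr] rm.
  have cD : `|X1 s - X2 s| @[s --> (al m)^'+] --> `|X1 (al m) - X2 (al m)|.
    by apply: cvg_norm; apply: cvgB; [apply: rc1|apply: rc2]; exact: hits_ge0 hits m.
  apply: (ler_cvg_to (cvg_cst _) cD); near=> s; apply: (inner m) => //.
    by near: s; exact: nbhs_right_le.
elim: n t => [|n IH] t nt tn.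
  by rewrite big_ord0 addr0 -[in leRHS]al0; exact: outer.
apply: (le_trans (outer _ _ nt tn)); rewrite big_ord_recr /= addrA.
have u0 : 0 < al n.+1 by apply: le_lt_trans (lt_al n); exact: hits_ge0 hits n.
have /cvg_ex[L1 XL1] := lc1 _ u0; have /cvg_ex[L2 XL2] := lc2 _ u0.
have <- := strong_path_jump hits Vdual Vst H1 XL1.
have <- := strong_path_jump hits Vdual Vst H2 XL2.
(* The difference at a hit is the difference of the left limits, controlled by the induction
   hypothesis at [al n], plus the difference of the jumps. *)
have -> : X1 (al n.+1) - X2 (al n.+1) = (L1 - L2) +
    (X1 (al n.+1) - L1 - (X2 (al n.+1) - L2)).
  by rewrite (subrACA _ L1) [RHS]addrC subrK.
apply: (le_trans (ler_normD _ _)); rewrite lerD2r.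
apply: le_trans (IH (al n) (lexx _) (lt_al n)).
have cD : `|X1 s - X2 s| @[s --> (al n.+1)^'-] --> `|L1 - L2|.
  by apply: cvg_norm; apply: cvgB.
apply: (ler_cvg_to cD (cvg_cst _)); near=> s; apply: outer.
  by near: s; exact: nbhs_left_ge.
by near: s; exact: nbhs_left_lt.
Unshelve. all: by end_near. Qed.

(** * Convergence of the marks hit by a path *)

(** By density, [|u - v|] is the infimum over [k] of [|u - q k| + |v - q k|], so a strict sublevel
    set is a countable union of measurable sets involving [f] and [g] separately. *)
Lemma measurable_dist (R : realType) (V : completeNormedModType R)
    d (T : measurableType d) (D : set T) (f g : T -> V) :
  separable V ->
  measurable_fun D (f : _ -> borel V) -> measurable_fun D (g : _ -> borel V) ->
  measurable_fun D (fun p => `|f p - g p|).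
Proof.
move=> /separable_dense_sequence[q qP] mf mg mD.
pose phi k p := `|f p - q k| + `|g p - q k|.
have cdist k : continuous (fun v : V => `|v - q k|).
  by move=> v; apply: cvg_norm; apply: cvgB; [exact: cvg_id|exact: cvg_cst].
have mphi k : measurable_fun D (phi k).
  by apply: measurable_funD; [exact: (measurable_continuous_comp (cdist k) mf)|
    exact: (measurable_continuous_comp (cdist k) mg)].
apply: (measurability _ (RGenInftyO.measurableE R)) => // _ [_ [c ->] <-].
rewrite (_ : _ `&` _ = \bigcup_k (D `&` phi k @^-1` `]-oo, c[)).
  by apply: bigcup_measurable => k _; apply: mphi.
apply/seteqP; split=> [p [Dp]|p [k _ [Dp]]]; rewrite /= !in_itv /=; last first.
  move=> phic; split => //; apply: le_lt_trans phic.
  by rewrite /phi (distrC (g p)) ler_distD.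
(* The distance to [q k] is paid twice in [phi k], once for [f p] and once for [g p], hence half of
   the gap. *)
move=> fgc; have e0 : 0 < (c - `|f p - g p|) / 2 by rewrite divr_gt0// subr_gt0.
have [k fk] := qP (f p) _ e0; exists k => //; split => //=; rewrite in_itv /=.
have := ler_distD (f p) (g p) (q k); rewrite (distrC (g p) (f p)) /phi; lra.
Qed.

Lemma measurable_mark_section (R : realType) (V : completeNormedModType R)
    dO (Omega : measurableType dO) dZ (Z : measurableType dZ)
    (eta : R -> Z -> Omega -> V) (w : Omega) (t : R) :
  measurable_mark eta ->
  measurable_fun (mark_strip 0 t)
    ((fun p : measurableTypeR R * Z => eta p.1 p.2 w) : _ -> borel V).
Proof.
move=> meta.
pose F : set (measurableTypeR R * Z * Omega) := `]0, +oo[ `*` setT `*` setT.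
have mF : measurable F by apply: measurableX => //; exact: measurableX.
pose g (p : measurableTypeR R * Z) := (p, w).
have mg : measurable_fun (mark_strip 0 t) g.
  by apply: measurable_funS (pair2_measurable w).
have gF : g @` mark_strip 0 t `<=` F.
  move=> _ [[s z] [/= + _] <-]; rewrite in_itv /= => /andP[s0 _].
  by split => //; split => //=; rewrite in_itv /= s0.
exact: (measurable_comp mF gF meta mg).
Qed.

Lemma cvg_dominated0 (R : realType) (r : nat -> R) (e : nat -> \bar R) :
  (forall m, 0 <= r m) -> (forall m, ((r m)%:E <= e m)%E) ->
  e m @[m --> \oo] --> 0%E -> r m @[m --> \oo] --> 0.
Proof.
move=> r0 re e0.
have : (r m)%:E @[m --> \oo] --> 0%:E.
  apply: (squeeze_cvge _ (cvg_cst 0%E) e0); apply: nearW => m.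
  by rewrite lee_fin r0 re.
exact: fine_cvg.
Qed.

(** On []al n, al n.+1]] the integral is just the distance of the two marks at the only hit, and it
    is at most the integral over []0, al n.+1]], which tends to zero. *)
Lemma hits_mark_cvg (R : realType) (V : completeNormedModType R)
    dZ (Z : measurableType dZ) (theta : point_function R Z) al z
    (hm : nat -> measurableTypeR R * Z -> V) (h : measurableTypeR R * Z -> V) n :
  hits_at theta al z -> separable V ->
  (forall m t, measurable_fun (mark_strip 0 t) (hm m : _ -> borel V)) ->
  (forall t, measurable_fun (mark_strip 0 t) (h : _ -> borel V)) ->
  (forall t, 0 < t -> (\int[pf_counting theta]_(p in mark_strip 0%R t)
     `|hm m p - h p|%:E)%E @[m --> \oo] --> 0%E) ->
  hm m (al n.+1, z n) @[m --> \oo] --> h (al n.+1, z n).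
Proof.
move=> hits Vsep mhm mh hmh; have [_ lt_al _ zn] := hits.
have u0 : 0 < al n.+1 := le_lt_trans (hits_ge0 hits n) (lt_al n).
have sub : @mark_strip R dZ Z (al n) (al n.+1) `<=` mark_strip 0 (al n.+1).
  move=> [s y] [/=]; rewrite in_itv /= => /andP[ns sn] _; split => //=.
  by rewrite in_itv /= sn (le_lt_trans (hits_ge0 hits n)).
have md m : measurable_fun (mark_strip 0 (al n.+1))
    (fun p => `|hm m p - h p|%:E).
  by apply/measurable_EFinP; exact: measurable_dist.
apply: (@cvg_sub0 _ _ _ _ _ _ (fun=> h (al n.+1, z n))); last exact: cvg_cst.
apply: norm_cvg0; apply: (cvg_dominated0 _ _ (hmh _ u0)) => [//|m].
rewrite -[leLHS](@integral_pf_counting_singleton _ _ _ theta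
  (mark_strip (al n) (al n.+1)) (fun p => `|hm m p - h p|%:E) _ _ _ _ (zn n)) //.
- by apply: ge0_subset_integral => //; exact: measurable_mark_strip.
- exact: measurable_mark_strip.
- by apply: measurable_funS (md m) => //; exact: measurable_mark_strip.
- exact: hits_strip_singleton hits (lexx _) (lt_al n).
Qed.

(** * Almost sure finiteness of the number of hits in bounded time *)

(** Hits all bounded by [t] would give infinitely many points in []0, t]]. The least index with
    [t < al n] is positive since [al 0 = 0 <= t], and its predecessor is the witness. *)
Lemma hits_unbounded (R : realType) dZ (Z : measurableType dZ)
    (theta : point_function R Z) al z t :
  hits_at theta al z -> 0 <= t ->
  finite_set (pf_points theta (mark_strip 0 t)) ->
  exists n, al n <= t /\ t < al n.+1.
Proof.
move=> hits t0 fin; have [al0 lt_al _ zn] := hits.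
have ex : exists n, t < al n.
  apply: contrapT => /forallNP H.
  have al_t n : al n <= t by rewrite leNgt; apply/negP/H.
  apply: infinite_nat; rewrite (_ : setT =
      (fun n => al n.+1) @^-1` pf_points theta (mark_strip 0 t)).
    apply: finite_preimage fin => m n _ _ mn.
    have [] := ltngtP m n => //; rewrite -ltnS -(hits_lt _ _ hits) mn ltxx//.
  apply/seteqP; split => // n _; exists (z n) => //; split => //=.
  by rewrite in_itv /= al_t (le_lt_trans (hits_ge0 hits n)).
have [] := find_ex_minn ex; case=> [|n] tn nmin; first by move: tn; rewrite al0 ltNge t0.
by exists n; split => //; rewrite leNgt; apply/negP => /nmin; rewrite ltnn.
Qed.

(** The generators make the events of exactly [k] points measurable; the value [+oo] is taken on the
    complement of their countable union. *)
Lemma measurable_pf_counting (R : realType) dO (Omega : measurableType dO)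
    dZ (Z : measurableType dZ) (Theta : Omega -> point_function R Z)
    (U : set (measurableTypeR R * Z)) :
  point_process Theta -> measurable U -> U `<=` `]0, +oo[ `*` setT ->
  measurable_fun setT (fun w => pf_counting (Theta w) U).
Proof.
move=> mTheta mU U0 _ Y mY; rewrite setTI.
pose E k := Theta @^-1` [set theta | (pf_points theta U #= `I_k)%card].
have mE k : measurable (E k).
  rewrite -[X in measurable X]setTI; apply: mTheta => //.
  by apply: sub_sigma_algebra; exists U, k.
have EP k w : E k w -> pf_counting (Theta w) U = k%:R%:E.
  move=> Ew; rewrite /pf_counting /counting asboolT; last by exists k.
  by rewrite (card_fset_set Ew).
have NEP w : (~ exists k, E k w) -> pf_counting (Theta w) U = +oo%E.
  by move=> nE; rewrite /pf_counting /counting asboolF.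
have -> : (fun w => pf_counting (Theta w) U) @^-1` Y =
    \bigcup_(k in [set k | Y k%:R%:E]) E k `|`
    (if `[< Y +oo%E >] then ~` \bigcup_k E k else set0).
  apply/seteqP; split => w /=.
    have [[k Ek]|nE] := pselect (exists k, E k w).
      by rewrite (EP _ _ Ek) => Yk; left; exists k.
    rewrite (NEP _ nE) => Yoo; right; rewrite asboolT// => -[k _ Ek].
    by apply: nE; exists k.
  move=> [[k Yk /EP -> //]|]; case: asboolP => // Yoo nE.
  by rewrite NEP// => -[k Ek]; apply: nE; exists k.
apply: measurableU; first by apply: bigcup_measurable => k _.
by case: asboolP => // _; apply: measurableC; apply: bigcup_measurable => k _.
Qed.

(** A finite expected count is almost surely finite. Integer horizons suffice by inclusion, so only
    countably many null sets are discarded. *)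
Lemma ae_finite_strip (R : realType) dO (Omega : measurableType dO)
    (P : probability Omega R) dZ (Z : measurableType dZ)
    (Theta : Omega -> point_function R Z) :
  finite_point_process P Theta ->
  {ae P, forall w, forall t, finite_set (pf_points (Theta w) (mark_strip 0 t))}.
Proof.
move=> [mTheta EN].
have : {ae P, forall w, forall k : nat,
    finite_set (pf_points (Theta w) (mark_strip 0 k.+1%:R))}.
  apply: ae_foralln => k.
  have mN : measurable_fun setT
      (fun w => pf_counting (Theta w) (@mark_strip R dZ Z 0 k.+1%:R)).
    apply: measurable_pf_counting => //; first exact: measurable_mark_strip.
    move=> [s z] [/= + _]; rewrite !in_itv /= => /andP[s0 _].
    by rewrite s0.
  have intN : P.-integrable setT
      (fun w => pf_counting (Theta w) (@mark_strip R dZ Z 0 k.+1%:R)).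
    apply/integrableP; split => //.
    under eq_integral do rewrite gee0_abs//.
    exact: EN.
  apply: filterS (integrable_ae measurableT intN) => w /(_ I).
  by rewrite /pf_counting /counting; case: asboolP.
apply: filterS => w fin t; apply: sub_finite_set (fin (Num.truncn t)).
move=> s [z sz [/= + _]]; rewrite in_itv /= => /andP[s0 st].
exists z => //; split => //=; rewrite in_itv /= s0 (le_trans st)//.
exact/ltW/truncnS_gt.
Qed.

(** * From processes to paths, and the limit of the approximations *)

Lemma hitting_times_hits (R : realType) dZ (Z : measurableType dZ)
    (theta : point_function R Z) (al : nat -> R) :
  al 0%N = 0 -> (forall m, al m < al m.+1) ->
  pf_dom theta = [set al m | m in [set m | (0 < m)%N]] ->
  exists z, hits_at theta al z.
Proof.
move=> al0 lt_al dom.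
have /choice[z zP] : forall m, exists z, theta (al m.+1) = Some z.
  move=> m; have : pf_dom theta (al m.+1) by rewrite dom; exists m.+1.
  by rewrite /pf_dom /=; case: (theta _) => // z _; exists z.
by exists z; split.
Qed.

Lemma strong_solution_path (R : realType) (V : completeNormedModType R)
    dO (Omega : measurableType dO) (P : probability Omega R)
    dZ (Z : measurableType dZ) (Theta : Omega -> point_function R Z)
    (alpha : nat -> Omega -> R) (A : V -> set V) (A0 : V -> V)
    (Vstar : set {linear V -> R^o}) (x : Omega -> V)
    (eta : R -> Z -> Omega -> V) (X : R -> Omega -> V) :
  measurable_mark eta ->
  strong_solution P Theta alpha A A0 Vstar x eta X ->
  {ae P, forall w, strong_path (Theta w) (alpha^~ w) A A0 Vstar
    (fun p => eta p.1 p.2 w) (X^~ w)}.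
Proof.
move=> meta [_]; apply: filterS => w [[X0 cadX domX WX] igX idX].
split => //; first by move=> t; exact: measurable_mark_section.
by move=> t Psi t0 VPsi; rewrite X0; exact: idX.
Qed.

Lemma cvg_sup_dist (R : realType) (V : normedModType R) (Xm : nat -> R -> V)
    (X : R -> V) (t : R) :
  ereal_sup [set `|Xm m s - X s|%:E | s in `[0, t]] @[m --> \oo] --> 0%E ->
  forall s, 0 <= s -> s <= t -> Xm m s @[m --> \oo] --> X s.
Proof.
move=> sup0 s s0 st; apply: (@cvg_sub0 _ _ _ _ _ _ (fun=> X s)); last exact: cvg_cst.
apply: norm_cvg0; apply: (cvg_dominated0 _ _ sup0) => [//|m].
by apply: ereal_sup_ubound; exists s => //=; rewrite in_itv /= s0.
Qed.

Theorem corollary0p3p4 (R : realType)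
  (dO : measure_display) (Omega : measurableType dO) (P : probability Omega R)
  (Pcomplete : measure_is_complete P)
  (dZ : measure_display) (Z : measurableType dZ)
  (Theta : Omega -> point_function R Z)
  (Theta_finite : finite_point_process P Theta)
  (Theta_infinite : {ae P, forall w, infinite_set (pf_dom (Theta w))})
  (alpha : nat -> Omega -> R) (alphaP : hitting_times P Theta alpha)
  (V : completeNormedModType R) (Vseparable : separable V)
  (A : V -> set V) (Adense : densely_defined A) (Amacc : m_accretive A)
  (T : R -> V -> V) (TA : associated_semigroup A T)
  (Tinv : domain_invariant A T)
  (A0 : V -> V) (A0gen : infinitesimal_generator A T A0)
  (Vstar : set {linear V -> R^o}) (Vstar_dual : Vstar `<=` dual V)
  (Vstar_sep : separates_points Vstar)
  (x : Omega -> V) (mx : measurable_fun setT (x : Omega -> borel V))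
  (eta : R -> Z -> Omega -> V) (meta : measurable_mark eta)
  (X1 X2 : R -> Omega -> V)
  (X1mild : mild_solution P Theta alpha A A0 Vstar x eta X1)
  (X2mild : mild_solution P Theta alpha A A0 Vstar x eta X2) :
  indistinguishable P X1 X2.
Proof.
have [accA _] := Amacc.
have A0A v : op_dom A v -> A v (A0 v) by move=> /(A0gen.1 v)[].
have [_ reg1 [x1 [eta1 [Y1 [_ meta1 sol1 cvg1]]]]] := X1mild.
have [_ reg2 [x2 [eta2 [Y2 [_ meta2 sol2 cvg2]]]]] := X2mild.
have path1 := ae_foralln (fun m => strong_solution_path (meta1 m) (sol1 m)).
have path2 := ae_foralln (fun m => strong_solution_path (meta2 m) (sol2 m)).
have [alpha0 _ dom_alpha] := alphaP.
(* A single null set is discarded for all approximations and all times; everything after this is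
   about one outcome [w]. *)
apply: filterS2 (filterI (filterI dom_alpha (ae_finite_strip Theta_finite))
  (filterI reg1 reg2)) (filterI (filterI path1 path2) (filterI cvg1 cvg2)).
move=> w [[[dom lt_al] fin] [[X10 _ _ _] [X20 _ _ _]]].
move=> [[{}path1 {}path2] [{}cvg1 {}cvg2]] t t0.
have [z hits] := hitting_times_hits (alpha0 w) lt_al dom.
have [n [nt tn]] := hits_unbounded hits t0 (fin t).
(* The approximation is given on positive horizons only, and [t] may be zero. *)
have t1 : 0 < t + 1 by rewrite ltr_wpDl.
have tt1 : t <= t + 1 by rewrite lerDl.
have cY1 s : 0 <= s -> s <= t -> Y1 m s w @[m --> \oo] --> X1 s w.
  by move=> s0 st; apply: (cvg_sup_dist (cvg1 _ t1).1 s0); exact: le_trans tt1.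
have cY2 s : 0 <= s -> s <= t -> Y2 m s w @[m --> \oo] --> X2 s w.
  by move=> s0 st; apply: (cvg_sup_dist (cvg2 _ t1).1 s0); exact: le_trans tt1.
have mark1 i : eta1 m (alpha i.+1 w) (z i) w @[m --> \oo] --> eta (alpha i.+1 w) (z i) w.
  apply: (hits_mark_cvg (hm := fun m p => eta1 m p.1 p.2 w)
    (h := fun p => eta p.1 p.2 w) hits Vseparable).
  - by move=> m s; exact: measurable_mark_section.
  - by move=> s; exact: measurable_mark_section.
  - by move=> s s0; case: (cvg1 _ s0).
have mark2 i : eta2 m (alpha i.+1 w) (z i) w @[m --> \oo] --> eta (alpha i.+1 w) (z i) w.
  apply: (hits_mark_cvg (hm := fun m p => eta2 m p.1 p.2 w)
    (h := fun p => eta p.1 p.2 w) hits Vseparable).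
  - by move=> m s; exact: measurable_mark_section.
  - by move=> s; exact: measurable_mark_section.
  - by move=> s s0; case: (cvg2 _ s0).
have cL : `|Y1 m t w - Y2 m t w| @[m --> \oo] --> `|X1 t w - X2 t w|.
  by apply: cvg_norm; apply: cvgB; [exact: cY1|exact: cY2].
pose rhs m : R := `|Y1 m 0 w - Y2 m 0 w| + \sum_(i < n)
  `|eta1 m (alpha i.+1 w) (z i) w - eta2 m (alpha i.+1 w) (z i) w|.
have cR : rhs m @[m --> \oo] --> (0 : R).
  (* Zero is written in the shape of the limit of [rhs]: both solutions start at [x w], and both
     families of marks tend to those of [eta]. *)
  rewrite (_ : 0 = `|X1 0 w - X2 0 w| + \sum_(i < n)
    `|eta (alpha i.+1 w) (z i) w - eta (alpha i.+1 w) (z i) w|); last first.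
    by rewrite X10 X20 subrr normr0 add0r big1// => i _; rewrite subrr normr0.
  apply: cvgD.
    by apply: cvg_norm; apply: cvgB; [exact: cY1|exact: cY2].
  apply: cvg_big => [|i _]; first exact: add_continuous.
  by apply: cvg_norm; apply: cvgB.
apply/eqP; rewrite -subr_eq0 -normr_le0; apply: (ler_cvg_to cL cR).
apply: nearW => m.
exact: (strong_path_contraction hits Vseparable Vstar_dual Vstar_sep accA A0A
  (path1 m) (path2 m) nt tn).
Qed.
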